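(* Let $\mathbb{K}\subset\mathbb{C}$ be a field and let $A^{(k)}(x)=\mathrm{diag}(l_1(x),\dots,l_m(x))$ be a diagonal $m\times m$ matrix, where $l_1,\dots,l_m\in\mathbb{K}[x_1,\dots,x_p]$ are homogeneous polynomials of degree $k$. Every matrix $A(x)=A^{(k)}(x)+(\text{terms of orders}>k)$ in $Mat(m,m,p)$ is two-sided equivalent to a matrix $B(x)=A^{(k)}(x)+(b_{ij}(x))$, with $(b_{ij})\in Mat(m,m,p)$, satisfying, for all $i,j\in\{1,\dots,m\}$, $$l_i^*\left(\tfrac{\partial}{\partial x}\right)b_{ij}(x)=0,\qquad l_j^*\left(\tfrac{\partial}{\partial x}\right)b_{ij}(x)=0 .$$
   Context: $m,p\ge 1$ are integers. $Mat(m,m,p)$ is the space of $m\times m$ matrices with entries in $\mathbb{K}[[x_1,\dots,x_p]]$. Two matrices $A,B\in Mat(m,m,p)$ are two-sided equivalent if $B(x)=U(x)A(x)V^{-1}(x)$ for some $U,V\in GL(m,\mathbb{K}[[x_1,\dots,x_p]])$. For a homogeneous polynomial $l_i(x)=\sum_{|I|=k}(l_i)_Ix^I$ of degree $k$, $l_i^*\left(\frac{\partial}{\partial x}\right)=\sum_{|I|=k}\overline{(l_i)_I}\,\frac{\partial^{|I|}}{\partial x^I}$, acting on formal power series.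
   Formalization: The formal theorem additionally assumes that the complex conjugates of the coefficients of the l_i lie in K (automatic if K is closed under conjugation); without this the statement fails, e.g. K=Q(a), a=2^{1/3}e^{2πi/3}, m=1, p=2, A=x+ay+y^2. *)

(* Defs.v *)
From HB Require Import structures.
From mathcomp Require Import all_boot all_order all_algebra.
From mathcomp Require Import boolp reals complex mpoly.

Set Implicit Arguments.
Unset Strict Implicit.
Unset Printing Implicit Defensive.

Import Order.TTheory GRing.Theory Num.Theory.

Local Open Scope ring_scope.

(** Formal power series [K[[x_1, ..., x_p]]]: a series is its family of
    coefficients, indexed by the exponents ['X_{1..p}], without any condition
    of finite support. *)
Record fps (p : nat) (K : Type) := Fps { fps_coef :> 'X_{1..p} -> K }.

Notation "{ 'fps' K [ p ] }" := (fps p K)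
  (at level 0, K, p at level 2, format "{ 'fps'  K [ p ] }") : type_scope.

HB.instance Definition _ (p : nat) (K : Type) := gen_eqMixin {fps K[p]}.
HB.instance Definition _ (p : nat) (K : Type) := gen_choiceMixin {fps K[p]}.

Lemma fpsP (p : nat) (K : Type) (f g : {fps K[p]}) : f =1 g <-> f = g.
Proof.
split=> [|-> //]; case: f g => [f] [g] /= fg.
by congr Fps; apply/funext.
Qed.

Section PowerSeriesRing.
Variables (p : nat) (K : comNzRingType).
Implicit Types f g h : {fps K[p]}.

Definition fps_zero : {fps K[p]} := Fps (fun=> 0).
Definition fps_opp f : {fps K[p]} := Fps (fun I => - f I).
Definition fps_add f g : {fps K[p]} := Fps (fun I => f I + g I).
Definition fps_scale (c : K) f : {fps K[p]} := Fps (fun I => c * f I).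

Definition fps_one : {fps K[p]} := Fps (fun I => (I == 0%MM)%:R).

(** Cauchy product, in the form of [mcoeffM]: the bounds on the degrees only
    make the set of the pairs [k] with [k.1 + k.2 = I] range over a finite
    type. *)
Definition fps_mul f g : {fps K[p]} :=
  Fps (fun I => \sum_(k : 'X_{1..p < (mdeg I).+1, (mdeg I).+1}
                      | I == (k.1 + k.2)%MM) f k.1 * g k.2).

Definition fps_of_mpoly (q : {mpoly K[p]}) : {fps K[p]} :=
  Fps (fun I => q@_I).

Fact fps_addA : associative fps_add.
Proof. by move=> f g h; apply/fpsP => I /=; rewrite addrA. Qed.
Fact fps_addC : commutative fps_add.
Proof. by move=> f g; apply/fpsP => I /=; rewrite addrC. Qed.
Fact fps_add0 : left_id fps_zero fps_add.
Proof. by move=> f; apply/fpsP => I /=; rewrite add0r. Qed.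
Fact fps_addN : left_inverse fps_zero fps_opp fps_add.
Proof. by move=> f; apply/fpsP => I /=; rewrite addNr. Qed.

HB.instance Definition _ := GRing.isZmodule.Build {fps K[p]}
  fps_addA fps_addC fps_add0 fps_addN.

Let trunc (d : nat) f : {mpoly K[p]} :=
  \sum_(I : 'X_{1..p < d}) f I *: 'X_[I].

Let truncE d f I : (mdeg I < d)%N -> (trunc d f)@_I = f I.
Proof. exact: mcoeff_mpoly. Qed.

Let fps_mulE (f g : {fps K[p]}) (q r : {mpoly K[p]}) I :
    (forall J, (mdeg J <= mdeg I)%N -> q@_J = f J) ->
    (forall J, (mdeg J <= mdeg I)%N -> r@_J = g J) ->
  fps_mul f g I = (q * r)@_I.
Proof.
move=> qf rg; rewrite mcoeffM; apply: eq_bigr => -[k1 k2] _ /=.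
by rewrite qf ?rg // -ltnS bmdeg.
Qed.

Let fps_mul_trunc d f g I : (mdeg I < d)%N ->
  fps_mul f g I = (trunc d f * trunc d g)@_I.
Proof.
by move=> Id; apply: fps_mulE => J JI; apply: truncE; apply: leq_ltn_trans Id.
Qed.

Fact fps_mulC : commutative fps_mul.
Proof.
move=> f g; apply/fpsP => I.
by rewrite !(@fps_mul_trunc (mdeg I).+1) // mulrC.
Qed.

Fact fps_mulA : associative fps_mul.
Proof.
move=> f g h; apply/fpsP => I; pose t := trunc (mdeg I).+1.
have tE u J : (mdeg J <= mdeg I)%N -> (t u)@_J = u J by move=> JI; rewrite truncE.
have tM u v J : (mdeg J <= mdeg I)%N -> (t u * t v)@_J = fps_mul u v J.
  by move=> JI; rewrite (@fps_mul_trunc (mdeg I).+1).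
rewrite (fps_mulE (tE f) (tM g h)) (fps_mulE (tM f g) (tE h)).
by rewrite mulrA.
Qed.

Fact fps_mul1 : left_id fps_one fps_mul.
Proof.
move=> f; apply/fpsP => I; pose t := trunc (mdeg I).+1 f.
rewrite (@fps_mulE _ _ 1 t) ?mul1r ?truncE // => J JI; last exact: truncE.
by rewrite mcoeff1.
Qed.

Fact fps_mulDl : left_distributive fps_mul +%R.
Proof.
move=> f g h; apply/fpsP => I /=; rewrite -big_split /=.
by apply: eq_bigr => k _; rewrite mulrDl.
Qed.

Fact fps_one_neq0 : fps_one != 0.
Proof.
apply/eqP => /(congr1 (fun f : {fps K[p]} => f 0%MM)) /= /eqP.
by rewrite eqxx oner_eq0.
Qed.

HB.instance Definition _ := GRing.Zmodule_isComNzRing.Build {fps K[p]}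
  fps_mulA fps_mulC fps_mul1 fps_mulDl fps_one_neq0.

Fact fps_scaleA a b f :
  fps_scale a (fps_scale b f) = fps_scale (a * b) f.
Proof. by apply/fpsP => I /=; rewrite mulrA. Qed.
Fact fps_scale1 : left_id 1 fps_scale.
Proof. by move=> f; apply/fpsP => I /=; rewrite mul1r. Qed.
Fact fps_scaleDr : right_distributive fps_scale +%R.
Proof. by move=> a f g; apply/fpsP => I /=; rewrite mulrDr. Qed.
Fact fps_scaleDl f : {morph fps_scale^~ f : a b / a + b}.
Proof. by move=> a b; apply/fpsP => I /=; rewrite mulrDl. Qed.

HB.instance Definition _ := GRing.Zmodule_isLmodule.Build K {fps K[p]}
  fps_scaleA fps_scale1 fps_scaleDr fps_scaleDl.

(** Units are the invertible series, the inverse being chosen; outside of the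
    units [fps_inv] is the identity, as [unitRingType] demands. *)
Definition fps_unit : {pred {fps K[p]}} :=
  fun f => `[< exists g, g * f = 1 >].

Definition fps_inv f : {fps K[p]} :=
  if pselect (exists g, g * f = 1) is left ex_g then projT1 (cid ex_g) else f.

Fact fps_mulV : {in fps_unit, left_inverse 1 fps_inv *%R}.
Proof.
move=> f /asboolP ex_g; rewrite /fps_inv.
by case: pselect => // ex_g'; case: (cid ex_g').
Qed.
Fact fps_unitP f g : g * f = 1 -> fps_unit f.
Proof. by move=> gf1; apply/asboolP; exists g. Qed.
Fact fps_inv_out : {in [predC fps_unit], fps_inv =1 id}.
Proof.
by move=> f /asboolPn nex_g; rewrite /fps_inv; case: pselect.
Qed.

HB.instance Definition _ := GRing.ComNzRing_hasMulInverse.Build {fps K[p]}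
  fps_mulV fps_unitP fps_inv_out.

Fact fps_of_mpoly_is_zmod_morphism : zmod_morphism fps_of_mpoly.
Proof. by move=> q r; apply/fpsP => I /=; rewrite mcoeffB. Qed.
Fact fps_of_mpoly_is_monoid_morphism : monoid_morphism fps_of_mpoly.
Proof.
split=> [|q r]; apply/fpsP => I /=; first by rewrite mcoeff1.
by rewrite mcoeffM.
Qed.

HB.instance Definition _ := GRing.isZmodMorphism.Build
  {mpoly K[p]} {fps K[p]} fps_of_mpoly fps_of_mpoly_is_zmod_morphism.
HB.instance Definition _ := GRing.isMonoidMorphism.Build
  {mpoly K[p]} {fps K[p]} fps_of_mpoly fps_of_mpoly_is_monoid_morphism.

(** [d^{|I|} f / d x^I]: the coefficient of [x^J] is
    [(I + J)! / J! * f_{I + J}]. *)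
Definition fps_derivm (I : 'X_{1..p}) f : {fps K[p]} :=
  Fps (fun J => f (I + J)%MM *+ \prod_(s < p) ((I + J)%MM s) ^_ (I s)).

Lemma fps_derivm_mpoly I (q : {mpoly K[p]}) :
  fps_derivm I (fps_of_mpoly q) = fps_of_mpoly q^`M[I].
Proof. by apply/fpsP => J /=; rewrite mcoeff_mderivm. Qed.

(** The differential operator [q(d/dx)]. *)
Definition fps_diffop (q : {mpoly K[p]}) f : {fps K[p]} :=
  \sum_(I <- msupp q) q@_I *: fps_derivm I f.

Definition fps_order_gt (k : nat) f : Prop :=
  forall I, (mdeg I <= k)%N -> f I = 0.

End PowerSeriesRing.

Definition map_fps (p : nat) (K L : Type) (phi : K -> L) (f : {fps K[p]})
  : {fps L[p]} := Fps (fun I => phi (f I)).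

(** [l^*(d/dx) f], where [iota] embeds the coefficient field [K] into [C]; the
    conjugates of the coefficients of [l] need not lie in [K], so the result
    is a series over [C]. *)
Definition conj_diffop (p : nat) (K : fieldType) (C : numClosedFieldType)
    (iota : {rmorphism K -> C}) (l : {mpoly K[p]}) (f : {fps K[p]})
  : {fps C[p]} :=
  fps_diffop (map_mpoly Num.conj (map_mpoly iota l)) (map_fps iota f).

Definition two_sided_equiv (m p : nat) (K : fieldType)
    (A B : 'M[{fps K[p]}]_m) : Prop :=
  exists U V : 'M[{fps K[p]}]_m,
    [/\ U \in unitmx, V \in unitmx & B = U *m A *m invmx V].

Definition diag_mpoly_mx (m p : nat) (K : fieldType)
    (l : 'I_m -> {mpoly K[p]}) : 'M[{fps K[p]}]_m :=
  diag_mx (\row_i fps_of_mpoly (l i)).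

(* Main.v *)
Require Import Defs.
From mathcomp Require Import all_boot all_order all_algebra.
From mathcomp Require Import boolp reals complex mpoly.

Import Order.TTheory GRing.Theory Num.Theory.
Local Open Scope ring_scope.

(** Write [D] for the diagonal matrix of the [l_i], [a := A - D], and look for
    the equivalence in the form [U = 1 + u], [V = 1 + v] with [u], [v] without
    constant term.  Then [U A = (D + b) V] says
      [b = (a + u a - b v) + (u D - D v)].
    Since [a] and [b] have order [> k], the degree [N] part of the residual
    [a + u a - b v] involves [b] only in degrees [< N] and [u], [v] only in
    degrees [< N - k], whereas the degree [N] part of [u D - D v] is linear in
    the degree [N - k] parts of [u] and [v], because the [l_i] are homogeneous
    of degree [k].  Hence the equation can be solved degree by degree, with [u]
    and [v] freely chosen in each new degree ([two_sided_reduction]): the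
    degree [N] part of [b_ij] can be any representative of that of the residual
    modulo the ideal generated by [l_i] and [l_j].

    The right representative is given by the Fischer product
    [<f, g> = sum_I I! f_I conj (g_I)], for which multiplication by [l] is
    adjoint to [l^*(d/dx)]: up to the factor [J!], the coefficient of [x^J] in
    [l^*(d/dx) f] is [<f, x^J l>] ([fps_diffop_fischer]).  So both equations
    for [b_ij] hold in degree [N - k] as soon as the degree [N] part of [b_ij]
    is orthogonal to the multiples of [l_i] and of [l_j], and orthogonal
    projection provides such a representative ([fischer_division]).

    The projection has to be defined over [K], which need not be stable under
    conjugation.  It is obtained from a linear system whose matrix is the Gram
    matrix of the vectors spanning the ideal; the entries of this system lie in
    [K] because the conjugates of the coefficients of the [l_i] do, and its
    solvability can be checked over the complex numbers, where the product is
    positive definite ([gram_orthogonal_projection]). *)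

(** * Orthogonal projection over a subfield *)

(** The sought combination [c] solves a system with the Gram matrix [G H] of
    the vectors [g s], and the right hand side [W H] lies in the row space of
    [H].  Over [C], positivity gives [G H Y = 0 -> H Y = 0], so [H] and [G H]
    have the same row space, and the solvability of a linear system does not
    depend on the field. *)
Lemma gram_orthogonal_projection (K : fieldType) (C : numClosedFieldType)
    (iota : {rmorphism K -> C}) (S T : finType) (d : T -> nat)
    (g : S -> T -> K) (w : T -> K) :
  (forall t, (0 < d t)%N) ->
  (forall s t, exists c, iota c = Num.conj (iota (g s t))) ->
  exists c : S -> K, forall s,
    \sum_t Num.conj (iota (g s t)) * iota (w t - \sum_s' c s' * g s' t)
           *+ d t = 0.
Proof.
move=> d_gt0 hconj.
have [h hE] : exists h : S -> T -> K,
    forall s t, iota (h s t) = Num.conj (iota (g s t)).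
  have {}hconj s t := cid (hconj s t).
  by exists (fun s t => sval (hconj s t)) => s t; case: (hconj s t).
pose G := \matrix_(i < #|S|, t < #|T|) g (enum_val i) (enum_val t).
pose H := \matrix_(t < #|T|, i < #|S|)
  (h (enum_val i) (enum_val t) *+ d (enum_val t)).
pose W := \row_(t < #|T|) w (enum_val t).
have HG : (H <= G *m H)%MS.
  rewrite -(map_submx iota) map_mxM submxE.
  set G' := map_mx iota G; set H' := map_mx iota H.
  suff kerZ n (Y : 'M_(_, n)) : G' *m (H' *m Y) = 0 -> H' *m Y = 0.
    by apply/eqP/kerZ; rewrite mulmxA mulmx_coker.
  set Z := H' *m Y => GZ.
  (* With Z = H' Y, the entries of Y^* G' are those of Z^* divided by the
     weights, so that Y^* (G' Z) = 0 is a vanishing sum of weighted squares of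
     moduli. *)
  have YG t y : \sum_i Num.conj (Y i y) * G' i t *+ d (enum_val t) =
      Num.conj (Z t y).
    rewrite !mxE rmorph_sum; apply: eq_bigr => i _.
    rewrite !mxE !rmorphM /= !rmorphMn /= hE.
    by rewrite conjCK mulrC mulrnAl.
  apply/matrixP => t y; rewrite [in RHS]mxE.
  pose e (t : 'I_#|T|) : C := (d (enum_val t))%:R.
  have e_gt0 t' : 0 < e t' by rewrite ltr0n d_gt0.
  have sum0 : \sum_t (e t)^-1 * (`|Z t y| ^+ 2) = 0.
    transitivity (\sum_i Num.conj (Y i y) * (G' *m Z) i y); last first.
      by rewrite GZ big1 // => i _; rewrite mxE mulr0.
    under [RHS]eq_bigr => i _ do rewrite mxE mulr_sumr.
    rewrite exchange_big; apply: eq_bigr => t' _ /=.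
    rewrite normCK -YG mulrC -mulrA mulrC -mulrA mulr_suml.
    apply: eq_bigr => i _.
    by rewrite -mulr_natr !mulrA mulfK // gt_eqF ?e_gt0.
  have nn t' : true -> 0 <= (e t')^-1 * (`|Z t' y| ^+ 2).
    by move=> _; rewrite mulr_ge0 ?invr_ge0 ?exprn_ge0 // ltW.
  have /(_ t isT)/eqP := psumr_eq0P nn sum0.
  by rewrite mulf_eq0 invr_eq0 gt_eqF //= sqrf_eq0 normr_eq0 => /eqP.
have /submxP [D WE] := submx_trans (submxMl W H) HG.
exists (fun s => D 0 (enum_rank s)) => s.
pose i := enum_rank s.
transitivity (iota (((W - D *m G) *m H) 0 i)); last first.
  by rewrite mulmxBl -mulmxA WE subrr mxE rmorph0.
rewrite mxE rmorph_sum (reindex (@enum_val T T)); last first.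
  by apply/onW_bij/enum_val_bij.
apply: eq_bigr => t _; rewrite !mxE enum_rankK rmorphM rmorphMn /= hE.
rewrite mulrC -mulrnAr; congr (iota (_ - _) * _).
rewrite (reindex (@enum_val S S)); last by apply/onW_bij/enum_val_bij.
by apply: eq_bigr => s' _; rewrite mxE enum_valK.
Qed.

(** * Fischer duality and division *)

Definition mnm_fact {p} (I : 'X_{1..p}) : nat := (\prod_(s < p) (I s)`!)%N.

Lemma mnm_fact_gt0 {p} (I : 'X_{1..p}) : (0 < mnm_fact I)%N.
Proof. by rewrite prodn_gt0 // => s; rewrite fact_gt0. Qed.

Lemma mnm_factD {p} (I J : 'X_{1..p}) :
  (mnm_fact (I + J)%MM =
   (\prod_(s < p) ((I + J)%MM s) ^_ (I s)) * mnm_fact J)%N.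
Proof.
rewrite -big_split; apply: eq_bigr => s _ /=.
by rewrite mnmDE -{3}(addKn (I s) (J s)) ffact_fact ?leq_addr.
Qed.

Lemma fps_coef_sum p (K : comNzRingType) (X : Type) (r : seq X) (P : pred X)
    (F : X -> {fps K[p]}) (I : 'X_{1..p}) :
  (\sum_(x <- r | P x) F x) I = \sum_(x <- r | P x) F x I.
Proof. by elim/big_rec2: _ => // x f c _ <-. Qed.

(** Multiplication by [q] and the operator [q(d/dx)] are adjoint: the right
    hand side is the Fischer product of [f] with ['X_[J] * q], without the
    conjugation.  The bound [d] only has to be large enough for every monomial
    of ['X_[J] * q] to be summed over. *)
Lemma fps_diffop_fischer p (K : comNzRingType) (q : {mpoly K[p]})
    (f : {fps K[p]}) (J : 'X_{1..p}) (d : nat) :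
  (forall I, I \in msupp q -> (mdeg (I + J) < d)%N) ->
  fps_diffop q f J *+ mnm_fact J =
  \sum_(I : 'X_{1..p < d}) ('X_[J] * q)@_I * f I *+ mnm_fact I.
Proof.
move=> qd; rewrite fps_coef_sum /= -sumrMnl.
have XqE I : ('X_[J] * q)@_I =
    \sum_(I' <- msupp q) q@_I' * ((I' + J)%MM == I)%:R.
  rewrite {1}(mpolyE q) mulr_sumr raddf_sum; apply: eq_bigr => I' _ /=.
  by rewrite -scalerAr mcoeffZ -mpolyXD mcoeffX addmC.
under [RHS]eq_bigr => I _ do rewrite XqE mulr_suml -sumrMnl.
rewrite exchange_big big_seq [RHS]big_seq; apply: eq_bigr => I Iq /=.
rewrite (bigD1 (BMultinom (qd _ Iq))) //= [X in _ + X]big1 ?addr0.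
  by rewrite eqxx mulr1 mnm_factD -mulrnAr -mulrnA mulrnAr.
move=> I'; rewrite bmeqP /= eq_sym => /negPf->.
by rewrite mulr0 mul0r mul0rn.
Qed.

(** The [u s] are the coefficients of the orthogonal projection of the degree
    [N] part of [w] onto the ideal generated by the [q s].  They are not taken
    homogeneous: only their degree [N - k] parts matter in degree [N]. *)
Lemma fischer_division p (K : fieldType) (C : numClosedFieldType)
    (iota : {rmorphism K -> C}) (S : finType) (k : nat)
    (q : S -> {mpoly K[p]}) (N : nat) (w : {fps K[p]}) :
  (forall s, q s \is k.-homog) ->
  (forall s I, exists c : K, iota c = Num.conj (iota (q s)@_I)) ->
  exists u : S -> {mpoly K[p]}, forall s (J : 'X_{1..p}),
    (mdeg J + k = N)%N ->
    conj_diffop iota (q s)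
      (w - \sum_s' fps_of_mpoly (u s') * fps_of_mpoly (q s')) J = 0.
Proof.
move=> qk qconj.
pose B := 'X_{1..p < N.+1}.
(* The spanning vectors are the degree N parts of all the x^J q_s with
   mdeg J <= N; they vanish unless mdeg J + k = N. *)
pose g (x : S * B) (I : B) : K :=
  if mdeg I == N then ('X_[x.2] * q x.1)@_I else 0.
have XqE (L : comNzRingType) (r : {mpoly L[p]}) (J I : 'X_{1..p}) :
    ('X_[J] * r)@_I = if (J <= I)%MM then r@_(I - J) else 0.
  case: ifP => [JI|nJI].
    by rewrite -{1}(submK JI) addmC -commr_mpolyX mcoeffMX.
  rewrite (mpolyE r) mulr_sumr raddf_sum big1 //= => I' _.
  rewrite -scalerAr mcoeffZ -mpolyXD mcoeffX; case: eqP => [IE|]; last first.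
    by rewrite mulr0.
  by rewrite -IE lem_addr in nJI.
have gconj x I : exists c, iota c = Num.conj (iota (g x I)).
  rewrite /g XqE; case: ifP => _; [case: ifP => _ // |];
    by exists 0; rewrite !rmorph0.
have [c cE] := @gram_orthogonal_projection K C iota _ B
  (fun I => mnm_fact I) g (fun I => w I) (fun I => mnm_fact_gt0 I) gconj.
exists (fun s => \sum_(J : B) c (s, J) *: 'X_[J]) => s J JN.
set b := w - _.
have JB : (mdeg J < N.+1)%N by rewrite ltnS -JN leq_addr.
set l := map_mpoly Num.conj (map_mpoly iota (q s)).
have lk I : I \in msupp l -> mdeg I = k.
  rewrite mcoeff_msupp !mcoeff_map_mpoly /= !fmorph_eq0 -mcoeff_msupp.
  exact: dhomog_mf.
suff : conj_diffop iota (q s) b J *+ mnm_fact J = 0.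
  by move=> /eqP; rewrite mulrn_eq0 -leqn0 leqNgt mnm_fact_gt0 => /eqP.
rewrite (@fps_diffop_fischer _ _ _ _ _ N.+1); last first.
  by move=> I /lk; rewrite mdegD => ->; rewrite addnC JN.
rewrite -[RHS](cE (s, BMultinom JB)); apply: eq_bigr => I _.
rewrite /g /=; case: eqP => [IN|IN].
  rewrite !XqE -/l; congr (_ * iota _ *+ _).
    by case: ifP => _; rewrite ?rmorph0 // !mcoeff_map_mpoly.
  congr (_ - _); rewrite fps_coef_sum.
  rewrite (eq_bigr (fun x => c (x.1, x.2) * ('X_[x.2] * q x.1)@_I)); last first.
    by case.
  rewrite -(pair_bigA _ (fun s J => c (s, J) * ('X_[J] * q s)@_I)).
  apply: eq_bigr => s' _; rewrite -rmorphM mulr_suml /= raddf_sum.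
  by apply: eq_bigr => J' _; rewrite -scalerAl /= mcoeffZ.
rewrite !rmorph0 mul0r XqE; case: ifP => [JI|_]; last by rewrite mul0r.
rewrite [X in X * _]memN_msupp_eq0 ?mul0r //; apply/negP => /lk IJ.
by apply: IN; rewrite -(submK JI) mdegD IJ addnC.
Qed.

(** * Recursion along the degree *)

(** [F] is a contraction for the ultrametric given by the rank, and its
    iterates are stationary below each rank. *)
Lemma causal_fixpoint (X Y : Type) (rk : X -> nat) (y0 : Y)
    (F : (X -> Y) -> X -> Y) :
  (forall f g x, (forall z, (rk z < rk x)%N -> f z = g z) -> F f x = F g x) ->
  exists f, F f =1 f.
Proof.
move=> causal; pose it n := iter n F (fun=> y0).
have stable n n' x : (rk x < n)%N -> (rk x < n')%N -> it n x = it n' x.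
  elim: n n' x => // n IHn [|n'] x // xn xn'; apply: causal => z zx.
  by apply: IHn; apply: leq_trans zx _.
exists (fun x => it (rk x).+1 x) => x; apply: causal => z zx.
exact: stable.
Qed.

Lemma fps_mul_congr p (K : comNzRingType) (f f' g g' : {fps K[p]})
    (I : 'X_{1..p}) :
  (forall J J' : 'X_{1..p}, (mdeg J + mdeg J' = mdeg I)%N ->
     f J * g J' = f' J * g' J') ->
  (f * g) I = (f' * g') I.
Proof.
by move=> E; apply: eq_bigr => -[J J'] /= /eqP IE; apply: E;
  rewrite -mdegD; apply/esym/(congr1 mdeg IE).
Qed.

(** The degree [N] part of a product with a form of degree [k] depends on the
    degree [N - k] part of the other factor only. *)
Lemma fps_mul_homog_congr p (K : comNzRingType) (k : nat) (q : {mpoly K[p]})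
    (f f' : {fps K[p]}) (I : 'X_{1..p}) :
  q \is k.-homog ->
  (forall J : 'X_{1..p}, (mdeg J + k = mdeg I)%N -> f J = f' J) ->
  (f * fps_of_mpoly q) I = (f' * fps_of_mpoly q) I.
Proof.
move=> qk ff'; apply: fps_mul_congr => J J' JJ' /=.
have [J'k|J'k] := eqVneq (mdeg J') k; first by rewrite ff' -?J'k.
by rewrite (dhomog_nemf_coeff qk J'k) !mulr0.
Qed.

Lemma conj_diffop_congr p (K : fieldType) (C : numClosedFieldType)
    (iota : {rmorphism K -> C}) (k : nat) (l : {mpoly K[p]})
    (f f' : {fps K[p]}) (J : 'X_{1..p}) :
  l \is k.-homog ->
  (forall I : 'X_{1..p}, mdeg I = (mdeg J + k)%N -> f I = f' I) ->
  conj_diffop iota l f J = conj_diffop iota l f' J.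
Proof.
move=> lk ff'; rewrite !fps_coef_sum; apply: eq_big_seq => I.
rewrite mcoeff_msupp !mcoeff_map_mpoly /= !fmorph_eq0 -mcoeff_msupp => Il.
by rewrite ff' // mdegD (dhomog_mf lk Il) addnC.
Qed.

Lemma conj_diffop0 p (K : fieldType) (C : numClosedFieldType)
    (iota : {rmorphism K -> C}) (l : {mpoly K[p]}) :
  conj_diffop iota l 0 = 0.
Proof.
apply/fpsP => J; rewrite fps_coef_sum big1 // => I _ /=.
by rewrite rmorph0 mul0rn mulr0.
Qed.

(** The inverse is the fixed point of the contraction [M |-> 1 - v M]. *)
Lemma fps_unitmx1D m p (K : comNzRingType) (v : 'M[{fps K[p]}]_m) :
  (forall i j, fps_order_gt 0 (v i j)) -> 1%:M + v \in unitmx.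
Proof.
move=> v_gt0.
pose M (f : 'I_m * 'I_m * 'X_{1..p} -> K) : 'M[{fps K[p]}]_m :=
  \matrix_(i, j) Fps (fun I => f (i, j, I)).
have [|f fE] := @causal_fixpoint _ K
  (fun x : 'I_m * 'I_m * 'X_{1..p} => mdeg x.2) 0
  (fun f x => (1%:M - v *m M f) x.1.1 x.1.2 x.2).
  move=> f g [[i j] I] /= fg; rewrite !mxE /= !fps_coef_sum; congr (_ - _).
  apply: eq_bigr => s _; apply: fps_mul_congr => J J' JJ'; rewrite !mxE /=.
  have [J0|J0] := posnP (mdeg J); first by rewrite v_gt0 ?J0 // !mul0r.
  by rewrite fg // -JJ' -[X in (X < _)%N]add0n ltn_add2r.
have E : M f = 1%:M - v *m M f.
  by apply/matrixP => i j; apply/fpsP => I; rewrite mxE /= -(fE (i, j, I)).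
have vM1 : (1%:M + v) *m M f = 1%:M by rewrite mulmxDl mul1mx {1}E subrK.
exact: (proj1 (mulmx1_unit vM1)).
Qed.

(** * Reduction to a normal form *)

Definition fps_hpart {p} {K : nmodType} (N : nat) (f : {fps K[p]}) :
    {fps K[p]} :=
  Fps (fun I => if mdeg I == N then f I else 0).

Lemma mx_hpartE m p (K : nmodType) N (M : 'M[{fps K[p]}]_m) i j I :
  map_mx (fps_hpart N) M i j I = if mdeg I == N then M i j I else 0.
Proof. by rewrite mxE. Qed.

(** The step [N] of the recursion determines [b] in degree [N], but [u] and [v]
    in degree [N - k]; hence the shift [d], equal to [0] or [k].  The parts of
    degree [<= n] are discarded, so that the order conditions hold at every
    stage of the recursion. *)
Definition mx_of_hparts {m p} {K : nmodType} (d n : nat)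
    (t : nat -> 'M[{fps K[p]}]_m) : 'M[{fps K[p]}]_m :=
  \matrix_(i, j) Fps (fun I : 'X_{1..p} =>
    if (n < mdeg I)%N then t (mdeg I + d)%N i j I else 0).

Lemma mx_of_hparts_order m p (K : comNzRingType) d n
    (t : nat -> 'M[{fps K[p]}]_m) i j :
  fps_order_gt n (mx_of_hparts d n t i j).
Proof. by move=> I In; rewrite mxE /= ltnNge In. Qed.

Lemma mx_of_hparts_congr m p (K : nmodType) d n N
    (t t' : nat -> 'M[{fps K[p]}]_m) i j (J : 'X_{1..p}) :
  (mdeg J + d < N)%N ->
  (forall N', (N' < N)%N -> t N' = t' N') ->
  mx_of_hparts d n t i j J = mx_of_hparts d n t' i j J.
Proof. by move=> JN tt'; rewrite !mxE /= tt'. Qed.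

(** An entry of [w + u D - D v]: the representatives of [w] modulo the tangent
    space at [D] of the orbit of [D], [x] being the pair of the entries of [u]
    and [v]. *)
Definition tangent_shift {p} {K : comNzRingType} (l1 l2 : {mpoly K[p]})
    (w : {fps K[p]}) (x : {fps K[p]} * {fps K[p]}) : {fps K[p]} :=
  w + x.1 * fps_of_mpoly l2 - x.2 * fps_of_mpoly l1.

Lemma tangent_shiftE p (K : comNzRingType) (l1 l2 : {mpoly K[p]}) w x I :
  tangent_shift l1 l2 w x I =
  w I + (x.1 * fps_of_mpoly l2) I - (x.2 * fps_of_mpoly l1) I.
Proof. by []. Qed.

(** The terms of the equation [(1 + u) (D + a) = (D + b) (1 + v)], solved for
    [b], that do not involve [D]. *)
Definition residual {m p} {K : comNzRingType} (a b u v : 'M[{fps K[p]}]_m) :=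
  a + u *m a - b *m v.

Lemma residual_order_gt m p (K : comNzRingType) k
    (a b u v : 'M[{fps K[p]}]_m) :
  (forall i j, fps_order_gt k (a i j)) ->
  (forall i j, fps_order_gt k (b i j)) ->
  forall i j, fps_order_gt k (residual a b u v i j).
Proof.
move=> a_gt b_gt i j I Ik.
rewrite !mxE /= a_gt // !fps_coef_sum !big1 ?subr0 ?addr0 //.
  move=> s _; rewrite (@fps_mul_congr _ _ _ 0 _ 0) ?mul0r // => J J' JJ'.
  by rewrite b_gt ?mul0r // (leq_trans _ Ik) // -JJ' leq_addr.
move=> s _; rewrite (@fps_mul_congr _ _ _ 0 _ 0) ?mul0r // => J J' JJ'.
by rewrite a_gt ?mulr0 ?mul0r // (leq_trans _ Ik) // -JJ' leq_addl.
Qed.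

(** Causality of the residual: as [a] and [b] have order [> k] and [v] has order
    [> 0], no product contributing to degree [N] involves [b] in degree [N], nor
    [u] or [v] in degree [N - k]. *)
Lemma residual_congr m p (K : comNzRingType) k N
    (a b b' u u' v v' : 'M[{fps K[p]}]_m) :
  (forall i j, fps_order_gt k (a i j)) ->
  (forall i j, fps_order_gt k (b i j)) ->
  (forall i j, fps_order_gt k (b' i j)) ->
  (forall i j, fps_order_gt 0 (v i j)) ->
  (forall i j, fps_order_gt 0 (v' i j)) ->
  (forall i j J, (mdeg J < N)%N -> b i j J = b' i j J) ->
  (forall i j J, (mdeg J + k < N)%N -> u i j J = u' i j J) ->
  (forall i j J, (mdeg J + k < N)%N -> v i j J = v' i j J) ->
  map_mx (fps_hpart N) (residual a b u v) =
  map_mx (fps_hpart N) (residual a b' u' v').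
Proof.
move=> a_gt b_gt b'_gt v_gt v'_gt bb' uu' vv'.
apply/matrixP => i j; apply/fpsP => I; rewrite !mx_hpartE.
case: eqP => // IN.
rewrite !mxE /= !fps_coef_sum; congr (_ + _ - _); apply: eq_bigr => s _;
    apply: fps_mul_congr => J J' JJ'.
  have [J'k|J'k] := leqP (mdeg J') k; first by rewrite a_gt // !mulr0.
  by rewrite uu' // -IN -JJ' ltn_add2l.
have [Jk|Jk] := leqP (mdeg J) k; first by rewrite b_gt // b'_gt // !mul0r.
have [J'0|J'0] := leqP (mdeg J') 0; first by rewrite v_gt // v'_gt // !mulr0.
rewrite bb' ?vv' // -IN -JJ'; first by rewrite addnC ltn_add2r.
by rewrite -[X in (X < _)%N]addn0 ltn_add2l.
Qed.

Lemma two_sided_equiv_residual m p (K : fieldType)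
    (D a b u v : 'M[{fps K[p]}]_m) :
  (forall i j, fps_order_gt 0 (u i j)) ->
  (forall i j, fps_order_gt 0 (v i j)) ->
  b = residual a b u v + u *m D - D *m v ->
  two_sided_equiv (D + a) (D + b).
Proof.
move=> /fps_unitmx1D U1 /fps_unitmx1D V1 bE; exists (1%:M + u), (1%:M + v).
split; [exact: U1 | exact: V1 |].
have E : (D + b) *m (1%:M + v) = (1%:M + u) *m (D + a).
  rewrite mulmxDr mulmx1 !mulmxDl mul1mx mulmxDr /residual in bE *.
  move: (u *m a) (b *m v) (u *m D) (D *m v) bE => P Q X Z ->.
  rewrite -!addrA; congr (_ + (_ + _)).
  by rewrite addKr [X + Q]addrC addKr addrC.
by rewrite -E (mulmxK V1).
Qed.

Lemma tangent_shift_mx m p (K : fieldType) (l : 'I_m -> {mpoly K[p]})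
    (w u v : 'M[{fps K[p]}]_m) i j :
  (w + u *m diag_mpoly_mx l - diag_mpoly_mx l *m v) i j =
  tangent_shift (l i) (l j) (w i j) (u i j, v i j).
Proof.
rewrite /diag_mpoly_mx mul_mx_diag mul_diag_mx !mxE /tangent_shift.
by congr (_ - _); apply: mulrC.
Qed.

(** Any rule [sol] for choosing a representative modulo the tangent space,
    degree by degree, is realized by an equivalence.  The series [w] is the
    degree [N] part of the residual; what matters is that the same [w] is given
    to [sol]. *)
Lemma two_sided_reduction (m p k : nat) (K : fieldType)
    (l : 'I_m -> {mpoly K[p]}) (A : 'M[{fps K[p]}]_m)
    (sol : 'I_m -> 'I_m -> nat -> {fps K[p]} -> {fps K[p]} * {fps K[p]}) :
  (forall i, l i \is k.-homog) ->
  (forall i j, fps_order_gt k ((A - diag_mpoly_mx l) i j)) ->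
  exists b : 'M[{fps K[p]}]_m,
    [/\ two_sided_equiv A (diag_mpoly_mx l + b),
        forall i j, fps_order_gt k (b i j)
      & forall i j N, (k < N)%N -> exists w : {fps K[p]},
          forall I : 'X_{1..p}, mdeg I = N ->
            b i j I = tangent_shift (l i) (l j) w (sol i j N w) I].
Proof.
move=> hl hA; set D := diag_mpoly_mx l; pose a := A - D.
pose Y : Type := ('M[{fps K[p]}]_m * 'M[{fps K[p]}]_m * 'M[{fps K[p]}]_m)%type.
pose b_ (t : nat -> Y) := mx_of_hparts 0 k (fun N => (t N).1.1).
pose u_ (t : nat -> Y) := mx_of_hparts k 0 (fun N => (t N).1.2).
pose v_ (t : nat -> Y) := mx_of_hparts k 0 (fun N => (t N).2).
pose w_ t := residual a (b_ t) (u_ t) (v_ t).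
pose G N (w : 'M[{fps K[p]}]_m) : Y :=
  (\matrix_(i, j) tangent_shift (l i) (l j) (w i j) (sol i j N (w i j)),
   \matrix_(i, j) (sol i j N (w i j)).1,
   \matrix_(i, j) (sol i j N (w i j)).2).
(* Only the degree N part of the residual may be given to the rule: its value
   at other degrees is not determined by the previous steps. *)
pose F (t : nat -> Y) (N : nat) := G N (map_mx (fps_hpart N) (w_ t)).
have causal f g N : (forall N', (N' < N)%N -> f N' = g N') -> F f N = F g N.
  move=> fg; apply: (congr1 (G N)); apply: (residual_congr _ _ _ k) => //;
    try by move=> i j; apply: mx_of_hparts_order.
  - by move=> i j J JN; apply: (@mx_of_hparts_congr _ _ _ _ _ N);
      [rewrite addn0 | move=> N' /fg ->].
  - by move=> i j J JN; apply: (@mx_of_hparts_congr _ _ _ _ _ N) => //;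
      move=> N' /fg ->.
  - by move=> i j J JN; apply: (@mx_of_hparts_congr _ _ _ _ _ N) => //;
      move=> N' /fg ->.
have [t tE] := causal_fixpoint _ Y id (0, 0, 0) F causal.
pose b := b_ t; pose u := u_ t; pose v := v_ t.
have bE i j (I : 'X_{1..p}) : (k < mdeg I)%N ->
    b i j I = (F t (mdeg I)).1.1 i j I.
  by move=> kI; rewrite tE mxE /= kI addn0.
have uE i j (I : 'X_{1..p}) : (0 < mdeg I)%N ->
    u i j I = (F t (mdeg I + k)%N).1.2 i j I.
  by move=> I0; rewrite tE mxE /= I0.
have vE i j (I : 'X_{1..p}) : (0 < mdeg I)%N ->
    v i j I = (F t (mdeg I + k)%N).2 i j I.
  by move=> I0; rewrite tE mxE /= I0.
have u_gt i j : fps_order_gt 0 (u i j) by apply: mx_of_hparts_order.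
have v_gt i j : fps_order_gt 0 (v i j) by apply: mx_of_hparts_order.
have b_gt i j : fps_order_gt k (b i j) by apply: mx_of_hparts_order.
have w_gt := residual_order_gt _ _ _ k a b u v hA b_gt.
(* In degrees <= k all the terms vanish; above k this is the step of the
   recursion at the degree of I. *)
have b_shift i j :
    b i j = tangent_shift (l i) (l j) (w_ t i j) (u i j, v i j).
  apply/fpsP => I; rewrite tangent_shiftE [(_, _).1]/= [(_, _).2]/=.
  have [Ik|kI] := leqP (mdeg I) k.
    have J0 (J : 'X_{1..p}) : (mdeg J + k = mdeg I)%N -> (mdeg J <= 0)%N.
      by move=> JI; rewrite -(leq_add2r k) JI.
    rewrite (@fps_mul_homog_congr _ _ _ _ (u i j) 0 _ (hl j)); last first.
      by move=> J /J0; apply: u_gt.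
    rewrite (@fps_mul_homog_congr _ _ _ _ (v i j) 0 _ (hl i)); last first.
      by move=> J /J0; apply: v_gt.
    by rewrite !mul0r subr0 addr0 w_gt // b_gt.
  have J0 (J : 'X_{1..p}) : (mdeg J + k = mdeg I)%N -> (0 < mdeg J)%N.
    by move=> JI; rewrite -(ltn_add2r k) JI.
  rewrite bE // mxE tangent_shiftE.
  congr (_ + _ - _); first by rewrite mx_hpartE eqxx.
    apply: (fps_mul_homog_congr _ _ _ _ _ _ _ (hl j)) => J JI.
    by rewrite uE ?J0 // JI [in RHS]mxE.
  apply: (fps_mul_homog_congr _ _ _ _ _ _ _ (hl i)) => J JI.
  by rewrite vE ?J0 // JI [in RHS]mxE.
have bD : b = w_ t + u *m D - D *m v.
  apply/matrixP => i j.
  exact: etrans (b_shift i j)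
                (esym (tangent_shift_mx _ _ _ l (w_ t) u v i j)).
exists b; split; first 1 last.
- exact: b_gt.
- move=> i j N kN; exists (fps_hpart N (w_ t i j)) => I IN.
  by rewrite bE ?IN // !mxE.
have -> : A = D + a by rewrite addrC subrK.
exact: two_sided_equiv_residual u_gt v_gt bD.
Qed.

Theorem corollary1p4
    (R : realType) (K : fieldType) (iota : {rmorphism K -> R[i]})
    (m p k : nat) (hm : (1 <= m)%N) (hp : (1 <= p)%N)
    (l : 'I_m -> {mpoly K[p]})
    (hl : forall i, l i \is k.-homog)
    (* the operators l_i^*(d/dx) have coefficients in K *)
    (hconj : forall i (I : 'X_{1..p}),
       exists c : K, iota c = Num.conj (iota (l i)@_I))
    (A : 'M[{fps K[p]}]_m)
    (hA : forall i j, fps_order_gt k ((A - diag_mpoly_mx l) i j)) :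
  exists b : 'M[{fps K[p]}]_m,
    two_sided_equiv A (diag_mpoly_mx l + b) /\
    forall i j : 'I_m,
      conj_diffop iota (l i) (b i j) = 0 /\
      conj_diffop iota (l j) (b i j) = 0.
Proof.
have sol i j N w : exists x : {fps K[p]} * {fps K[p]},
    forall J : 'X_{1..p}, (mdeg J + k = N)%N ->
      conj_diffop iota (l i) (tangent_shift (l i) (l j) w x) J = 0 /\
      conj_diffop iota (l j) (tangent_shift (l i) (l j) w x) J = 0.
  have [] := @fischer_division p K R[i] iota bool k
    (fun s => if s then l i else l j) N w; [by case | by case |].
  (* Division subtracts both multiples, whereas a tangent shift adds the
     multiple of l_j. *)
  move=> u uP; exists (- fps_of_mpoly (u false), fps_of_mpoly (u true)).
  move=> J JN; have := (uP true J JN, uP false J JN).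
  rewrite big_bool /=.
  set r := w - _; set r' := tangent_shift _ _ _ _.
  have -> : r' = r.
    by rewrite /r' /tangent_shift /r mulNr opprD addrA [LHS]addrAC.
  by case=> di dj; split; [exact: di | exact: dj].
have [b [equivA b_gt bE]] :=
  @two_sided_reduction m p k K l A (fun i j N w => sval (cid (sol i j N w)))
    hl hA.
exists b; split; first exact: equivA.
have diffop0 i j s : (forall N w (J : 'X_{1..p}), (mdeg J + k = N)%N ->
    conj_diffop iota (l s)
      (tangent_shift (l i) (l j) w (sval (cid (sol i j N w)))) J = 0) ->
    conj_diffop iota (l s) (b i j) = 0.
  move=> sol0; apply/fpsP => J.
  (* The coefficients of degree k are zero, since b has order > k; the division
     only controls the higher ones. *)
  have [Jk|kJ] := leqP (mdeg J + k) k.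
    rewrite (@conj_diffop_congr _ _ _ _ _ _ _ 0 _ (hl s)).
      by rewrite conj_diffop0.
    by move=> I IJ; rewrite b_gt ?IJ.
  have [w wE] := bE i j _ kJ.
  rewrite (@conj_diffop_congr _ _ _ _ _ _ _ _ _ (hl s) wE).
  exact: sol0.
by move=> i j; split; apply: diffop0 => N w J /(svalP (cid (sol i j N w))) [].
Qed.
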